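(* For every $i=1,\dots,n-1$ and every $k\ge 1$, the $q$-divided difference operator $\partial_i$ annihilates the $k$-th twisted elementary $q$-symmetric polynomial: $\partial_i(\widetilde e_k)=0$. Hence $$\widetilde\Lambda^q_n\subseteq\bigcap_{i=1}^{n-1}\ker(\partial_i).$$
   Context: Let $\Bbbk$ be a commutative ring and $q\in\Bbbk^\times$ a unit. $P^q_n=\Bbbk\langle x_1,\dots,x_n\rangle/(x_jx_i-qx_ix_j : i<j)$, graded with $|x_i|=1$. Put $\widetilde x_j=q^{j-1}x_j$ and $$\widetilde e_k=\sum_{1\le i_1<\dots<i_k\le n}\widetilde x_{i_1}\cdots\widetilde x_{i_k}.$$ $\widetilde\Lambda^q_n$ is the subalgebra of $P^q_n$ generated by $\widetilde e_1,\dots,\widetilde e_n$. For $1\le i\le n-1$, $\sigma_i$ is given by $\sigma_i(x_i)=qx_{i+1}$, $\sigma_i(x_{i+1})=q^{-1}x_i$, $\sigma_i(x_j)=qx_j$ for $j>i+1$, $\sigma_i(x_j)=q^{-1}x_j$ for $j<i$, extended multiplicatively. The $q$-divided difference operator $\partial_i$ is the linear operator $P^q_n\to P^q_n$ defined by $\partial_i(x_i)=q$, $\partial_i(x_{i+1})=-1$, $\partial_i(x_j)=0$ for $j\ne i,i+1$, and the $q$-Leibniz rule $\partial_i(fg)=\partial_i(f)g+\sigma_i(f)\partial_i(g)$ for all $f,g\in P^q_n$.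
   Formalization: For n ≥ 2, σ_i and ∂_i are not well defined on P^q_n unless q²=1, as σ_i maps a defining relation to (1−q²)x_i x_{i+1}. The claim is proved on P^q_n for any such operators that exist, and for every unit q on the free algebra, before imposing the relations. *)

(* Defs.v *)
From HB Require Import structures.
From mathcomp Require Import all_boot all_order all_algebra.
From mathcomp Require Import generic_quotient ring_quotient.
From mathcomp Require Import boolp.
From mathcomp Require Import finmap monalg.

Set Implicit Arguments.
Unset Strict Implicit.
Unset Printing Implicit Defensive.

Import GRing.Theory.

Local Open Scope ring_scope.
Local Open Scope quotient_scope.

(* Variables are indexed by 'I_n, hence are x_0, ..., x_(n-1).                *)

(** * The free algebra *)

Definition free_alg (R : comNzRingType) (n : nat) : Type :=
  {malg R[{fmonom 'I_n}]}.

HB.instance Definition _ (R : comNzRingType) (n : nat) :=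
  GRing.Lalgebra.on (free_alg R n).

Fact malg_mulC (R : comNzRingType) (K : monomType) (c : R) (g : {malg R[K]}) :
  g * c%:MP = c *: g.
Proof.
rewrite -mul_malgC !malgM_def fgmulgU fgmulUg.
by apply: eq_bigr => k _; rewrite mulm1 mul1m mulrC.
Qed.

Fact free_alg_scaleAr (R : comNzRingType) (n : nat)
    (c : R) (f g : free_alg R n) : c *: (f * g) = f * (c *: g).
Proof.
by rewrite scalerAl -[c *: f]malg_mulC -[c *: g]mul_malgC mulrA.
Qed.

HB.instance Definition _ (R : comNzRingType) (n : nat) :=
  GRing.Lalgebra_isAlgebra.Build R (free_alg R n) (@free_alg_scaleAr R n).

Definition free_var (R : comNzRingType) (n : nat) (j : 'I_n) : free_alg R n :=
  << fmu j >>.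

(** * The algebra of q-polynomials *)

Definition ideal2_closed (A : nzRingType) (I : {pred A}) : Prop :=
  zmod_closed I /\ (forall a b : A, {in I, forall u, a * u * b \in I}).

Section QPoly.
Variables (R : comNzRingType) (n : nat) (q : R).
Local Notation F := (free_alg R n).
Local Notation X := (@free_var R n).

Definition qrel (i j : 'I_n) : F := X j * X i - q *: (X i * X j).

(* The two-sided ideal generated by the qrel i j for i < j, as the            *)
(* intersection of all two-sided ideals containing them.                      *)
Definition qideal : {pred F} := fun f =>
  `[< forall I : {pred F}, ideal2_closed I ->
        (forall i j : 'I_n, (i < j)%N -> qrel i j \in I) -> f \in I >].

Fact qideal_ideal2 : ideal2_closed qideal.
Proof.
split; first split.
- by apply/asboolP => I [[I0 _] _] _.
- move=> f g /asboolP If /asboolP Ig; apply/asboolP => I HI HX.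
  by case: (HI) => [[_ IB] _]; apply: IB; [apply: If | apply: Ig].
- move=> a b f /asboolP If; apply/asboolP => I HI HX.
  by case: (HI) => _; apply; apply: If.
Qed.

Fact qrel_qideal (i j : 'I_n) : (i < j)%N -> qrel i j \in qideal.
Proof. by move=> ij; apply/asboolP => I _; apply. Qed.

Fact qideal_min (I : {pred F}) : ideal2_closed I ->
  (forall i j : 'I_n, (i < j)%N -> qrel i j \in I) -> {subset qideal <= I}.
Proof. by move=> HI HX f /asboolP; apply. Qed.

HB.instance Definition _ :=
  GRing.isZmodClosed.Build F qideal qideal_ideal2.1.

Fact qidealMl a u : u \in qideal -> a * u \in qideal.
Proof. by move=> uI; rewrite -[a * u]mulr1; apply: qideal_ideal2.2. Qed.

Fact qidealMr a u : u \in qideal -> u * a \in qideal.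
Proof. by move=> uI; rewrite -[u * a]mul1r mulrA; apply: qideal_ideal2.2. Qed.

Fact qidealZ c u : u \in qideal -> c *: u \in qideal.
Proof. by move=> uI; rewrite -mul_malgC; apply: qidealMl. Qed.

Fact qideal1 : 1 \notin qideal.
Proof.
pose e : {rmorphism {malg R[{fmonom 'I_n}]} -> R} :=
  mcoeff (@mone {fmonom 'I_n}).
have eX j : e (X j) = 0 by rewrite /= mcoeffU fmP fm1 fmuE.
have eZ c f : e (c *: f) = c * e f by rewrite /= mcoeffZ.
have e1 : e (1 : F) = 1 by exact: rmorph1.
have eM f g : e (f * g : F) = e f * e g by exact: rmorphM.
have eB f g : e (f - g : F) = e f - e g by exact: rmorphB.
have e0 : e (0 : F) = 0 by exact: rmorph0.
apply/negP => /(@qideal_min [pred f | e f == 0]) H.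
suff: 1 \in [pred f | e f == 0] by rewrite inE e1 oner_eq0.
apply: H; first split; first split.
- by rewrite inE e0.
- by move=> f g; rewrite !inE eB => /eqP-> /eqP->; rewrite subrr.
- by move=> a b f; rewrite !inE !eM => /eqP->; rewrite mulr0 mul0r.
- move=> i j _; rewrite inE; apply/eqP.
  have eXX k l : e (X k * X l) = 0.
    by apply: etrans (eM _ _) _; rewrite eX mul0r.
  apply: etrans (eB _ _) _; rewrite eXX sub0r.
  have -> : e (q *: (X i * X j)) = 0.
    by apply: etrans (eZ _ _) _; rewrite eXX mulr0.
  by rewrite oppr0.
Qed.

Definition qpoly_alg : Type := {ideal_quot qideal}.
HB.instance Definition _ := GRing.Zmodule.on qpoly_alg.
HB.instance Definition _ := EqQuotient.on qpoly_alg.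

Definition qpi (f : F) : qpoly_alg := \pi_({ideal_quot qideal}) f.

Fact qpiP (f g : F) : reflect (qpi f = qpi g) (f - g \in qideal).
Proof. by rewrite Quotient.idealrBE; apply: eqP. Qed.

Fact qpi_reprK (p : qpoly_alg) : qpi (repr p) = p.
Proof. exact: (@reprK _ {ideal_quot qideal}). Qed.

Fact repr_qpi (f : F) : repr (qpi f) - f \in qideal.
Proof. by apply/qpiP; rewrite qpi_reprK. Qed.

Fact qpi_zmod_morphism : zmod_morphism qpi.
Proof. by move=> f g; rewrite /qpi !piE. Qed.

HB.instance Definition _ := GRing.isZmodMorphism.Build F qpoly_alg qpi
  qpi_zmod_morphism.

Definition qone : qpoly_alg := qpi 1.
Definition qmul (p r : qpoly_alg) : qpoly_alg := qpi (repr p * repr r).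
Definition qscale (c : R) (p : qpoly_alg) : qpoly_alg := qpi (c *: repr p).

Fact qpi_mul f g : qmul (qpi f) (qpi g) = qpi (f * g).
Proof.
apply/qpiP; set f' := repr _; set g' := repr _.
have -> : f' * g' - f * g = (f' - f) * g' + f * (g' - g).
  by rewrite mulrBl mulrBr addrA subrK.
apply: rpredD; first exact/qidealMr/repr_qpi.
exact/qidealMl/repr_qpi.
Qed.

Fact qpi_scale c f : qscale c (qpi f) = qpi (c *: f).
Proof. by apply/qpiP; rewrite -scalerBr; apply/qidealZ/repr_qpi. Qed.

Fact qmulA : associative qmul.
Proof.
move=> p r s; rewrite -[p]qpi_reprK -[r]qpi_reprK -[s]qpi_reprK.
by rewrite !qpi_mul mulrA.
Qed.

Fact qmul1r : left_id qone qmul.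
Proof. by move=> p; rewrite -[p]qpi_reprK qpi_mul mul1r. Qed.

Fact qmulr1 : right_id qone qmul.
Proof. by move=> p; rewrite -[p]qpi_reprK qpi_mul mulr1. Qed.

Fact qmulDl : left_distributive qmul +%R.
Proof.
move=> p r s; rewrite -[p]qpi_reprK -[r]qpi_reprK -[s]qpi_reprK.
by rewrite -raddfD !qpi_mul mulrDl raddfD.
Qed.

Fact qmulDr : right_distributive qmul +%R.
Proof.
move=> p r s; rewrite -[p]qpi_reprK -[r]qpi_reprK -[s]qpi_reprK.
by rewrite -raddfD !qpi_mul mulrDr raddfD.
Qed.

Fact qone_neq0 : qone != 0.
Proof.
apply/eqP; rewrite -(raddf0 qpi) => /qpiP.
by rewrite subr0 (negPf qideal1).
Qed.

HB.instance Definition _ := GRing.Zmodule_isNzRing.Build qpoly_alg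
  qmulA qmul1r qmulr1 qmulDl qmulDr qone_neq0.

Fact qscaleA a b p : qscale a (qscale b p) = qscale (a * b) p.
Proof. by rewrite -[p]qpi_reprK !qpi_scale scalerA. Qed.

Fact qscale1 : left_id 1 qscale.
Proof. by move=> p; rewrite -[p]qpi_reprK qpi_scale scale1r. Qed.

Fact qscaleDr : right_distributive qscale +%R.
Proof.
move=> c p r; rewrite -[p]qpi_reprK -[r]qpi_reprK.
by rewrite -raddfD !qpi_scale scalerDr raddfD.
Qed.

Fact qscaleDl p : {morph qscale^~ p : a b / a + b}.
Proof.
by move=> a b; rewrite -[p]qpi_reprK !qpi_scale scalerDl raddfD.
Qed.

HB.instance Definition _ := GRing.Zmodule_isLmodule.Build R qpoly_alg
  qscaleA qscale1 qscaleDr qscaleDl.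

Fact qscaleAl c (p r : qpoly_alg) : c *: (p * r) = c *: p * r.
Proof.
rewrite -[p]qpi_reprK -[r]qpi_reprK /GRing.mul /GRing.scale /=.
by rewrite !(qpi_mul, qpi_scale) scalerAl.
Qed.

HB.instance Definition _ := GRing.Lmodule_isLalgebra.Build R qpoly_alg qscaleAl.

Fact qscaleAr c (p r : qpoly_alg) : c *: (p * r) = p * (c *: r).
Proof.
rewrite -[p]qpi_reprK -[r]qpi_reprK /GRing.mul /GRing.scale /=.
by rewrite !(qpi_mul, qpi_scale) scalerAr.
Qed.

HB.instance Definition _ := GRing.Lalgebra_isAlgebra.Build R qpoly_alg qscaleAr.

Fact qpi_monoid_morphism : monoid_morphism qpi.
Proof.
by split=> [|f g]; [exact: erefl | exact: (esym (qpi_mul f g))].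
Qed.

HB.instance Definition _ := GRing.isMonoidMorphism.Build F qpoly_alg qpi
  qpi_monoid_morphism.

Fact qpi_scalable : scalable qpi.
Proof. by move=> c f; rewrite -qpi_scale. Qed.

HB.instance Definition _ := GRing.isScalable.Build R F qpoly_alg *:%R qpi
  qpi_scalable.

Definition qvar (j : 'I_n) : qpoly_alg := qpi (X j).

Fact qvar_comm (i j : 'I_n) : (i < j)%N ->
  qvar j * qvar i = q *: (qvar i * qvar j).
Proof.
move=> ij; rewrite /qvar -!rmorphM -linearZ /=.
by apply/qpiP/qrel_qideal.
Qed.

End QPoly.

(** * Twisted elementary q-symmetric polynomials and q-divided differences *)

(* i : 'I_n.-1 indexes the n - 1 pairs of consecutive variables; var_lo i and *)
(* var_hi i are the positions of x_i and x_(i+1).                             *)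
Definition var_lo (n : nat) (i : 'I_n.-1) : 'I_n := widen_ord (leq_pred n) i.

Fact var_hi_subproof (n : nat) (i : 'I_n.-1) : (i.+1 < n)%N.
Proof. by rewrite -ltn_predRL. Qed.

Definition var_hi (n : nat) (i : 'I_n.-1) : 'I_n :=
  Ordinal (var_hi_subproof i).

Section QOperators.
Variables (R : comUnitRingType) (n : nat) (q : R).
Variables (A : algType R) (x : 'I_n -> A).

(* The exponent is j - 1 for variables numbered from 1.                       *)
Definition twisted_var (j : 'I_n) : A := q ^+ j *: x j.

Definition twisted_esym (k : nat) : A :=
  \sum_(t : k.-tuple 'I_n | sorted (fun a b : 'I_n => (a < b)%N) t)
     \prod_(j <- t) twisted_var j.

Definition gen_subalg (S : A -> Prop) (f : A) : Prop :=
  forall B : {pred A}, subalg_closed B -> (forall g, S g -> g \in B) -> f \in B.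

Definition twisted_Lambda : A -> Prop :=
  gen_subalg (fun g => exists k, (1 <= k <= n)%N /\ g = twisted_esym k).

(* Multiplicativity and linearity are not part of is_sigma and is_qdivdiff:   *)
(* they are carried by the types {lrmorphism A -> A} and {linear A -> A} of   *)
(* the maps to which these predicates are applied.                            *)
Definition is_sigma (i : 'I_n.-1) (s : A -> A) : Prop :=
  [/\ s (x (var_lo i)) = q *: x (var_hi i),
      s (x (var_hi i)) = q^-1 *: x (var_lo i),
      forall j : 'I_n, (var_hi i < j)%N -> s (x j) = q *: x j
    & forall j : 'I_n, (j < var_lo i)%N -> s (x j) = q^-1 *: x j].

Definition is_qdivdiff (i : 'I_n.-1) (s d : A -> A) : Prop :=
  [/\ d (x (var_lo i)) = q%:A,
      d (x (var_hi i)) = -1,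
      forall j : 'I_n, j != var_lo i -> j != var_hi i -> d (x j) = 0
    & forall f g : A, d (f * g) = d f * g + s f * d g].

End QOperators.

(** * Existence of the operators *)

(* On the free algebra sigma_i and del_i exist for every q. They descend to   *)
(* qpoly_alg n q when q ^+ 2 = 1; in general sigma_i does not respect the     *)
(* relations, as it maps x_(i+1) x_i - q x_i x_(i+1) to                       *)
(* (1 - q ^+ 2) x_i x_(i+1).                                                  *)

(* Products of the matrices [[sigma x_j, del x_j], [0, x_j]] encode the       *)
(* q-Leibniz rule.                                                            *)
Section Existence.
Variables (R : comUnitRingType) (n : nat) (q : R).
Local Notation F := (free_alg R n).
Local Notation X := (@free_var R n).

Variables (A : algType R) (rho : {lrmorphism F -> A}) (i : 'I_n.-1).
Local Notation x j := (rho (X j)).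
Local Notation lo := (var_lo i).
Local Notation hi := (var_hi i).

Definition sigma_img (j : 'I_n) : A :=
  if j == lo then q *: x hi else if j == hi then q^-1 *: x lo else
  if (j < lo)%N then q^-1 *: x j else q *: x j.

Definition del_img (j : 'I_n) : A :=
  if j == lo then q%:A else if j == hi then -1 else 0.

Definition op_mx (j : 'I_n) : 'M[A]_2 := \matrix_(a, b)
  if a == 0 then (if b == 0 then sigma_img j else del_img j)
  else (if b == 0 then 0 else x j).

Definition op_word (w : {fmonom 'I_n}) : 'M[A]_2 := \prod_(j <- w) op_mx j.

Fact op_word_mmorphism : mmorphism op_word.
Proof.
split; first by move=> u v; rewrite /op_word fmM big_cat.
by rewrite /op_word fm1 big_nil.
Qed.

HB.instance Definition _ := isMultiplicative.Build {fmonom 'I_n} 'M[A]_2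
  op_word op_word_mmorphism.

Definition op_scalar : R -> 'M[A]_2 := fun c => (c%:A)%:M.

Fact op_scalar_zmod : zmod_morphism op_scalar.
Proof. by move=> a b; rewrite /op_scalar scalerBl raddfB. Qed.

Fact op_scalar_monoid : monoid_morphism op_scalar.
Proof.
split; first by rewrite /op_scalar scale1r.
move=> a b; rewrite /op_scalar -[RHS]scalar_mxM.
by rewrite -scalerAl mul1r scalerA.
Qed.

HB.instance Definition _ := GRing.isZmodMorphism.Build R 'M[A]_2 op_scalar
  op_scalar_zmod.
HB.instance Definition _ := GRing.isMonoidMorphism.Build R 'M[A]_2 op_scalar
  op_scalar_monoid.

Fact op_scalar1 : op_scalar 1 = 1. Proof. exact: op_scalar_monoid.1. Qed.

Definition op (f : F) : 'M[A]_2 := mmap op_scalar op_word f.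

Fact op_scalarE c (M : 'M[A]_2) a b : (op_scalar c * M) a b = c *: M a b.
Proof. by rewrite [_ * M]mul_scalar_mx mxE -scalerAl mul1r. Qed.

Fact op_scalar_comm c (M : 'M[A]_2) : GRing.comm (op_scalar c) M.
Proof.
apply/matrixP => a b; rewrite op_scalarE.
rewrite [(_ * op_scalar c)]/GRing.mul /= mxE (bigD1 b) //= big1 => [|k kb].
  by rewrite mxE eqxx mulr1n addr0 -scalerAr mulr1.
by rewrite mxE (negPf kb) mulr0n mulr0.
Qed.

Fact op_monoid : monoid_morphism op.
Proof.
have [opM op1] :
    (forall f g : {malg R[{fmonom 'I_n}]}, op (f * g) = op f * op g)
    /\ op 1 = 1.
  split; last exact: mmap1.
  apply: (commr_mmap_is_multiplicative _).1 => g m m'.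
  exact: op_scalar_comm.
by split.
Qed.

Fact op_zmod : zmod_morphism op.
Proof. by move=> f g; apply: (mmap_is_additive (f := op_scalar)). Qed.

HB.instance Definition _ := GRing.isZmodMorphism.Build F 'M[A]_2 op op_zmod.
HB.instance Definition _ := GRing.isMonoidMorphism.Build F 'M[A]_2 op op_monoid.

Fact opZ c f a b : op (c *: f) a b = c *: op f a b.
Proof. by rewrite /op mmapZ op_scalarE. Qed.

Fact op_mono (w : {fmonom 'I_n}) : op << w >> = op_word w.
Proof. by rewrite /op mmapU [X in X * _]op_scalar1 mul1r. Qed.

Fact op_var j : op (X j) = op_mx j.
Proof.
rewrite /free_var op_mono.
by rewrite /op_word fmuE /= big_seq1.
Qed.

Fact mul2E (M N : 'M[A]_2) a b : (M * N) a b = M a 0 * N 0 b + M a 1 * N 1 b.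
Proof.
rewrite [M * N]/GRing.mul /= mxE !big_ord_recl big_ord0 addr0.
by congr (M _ _ * N _ _ + M _ _ * N _ _); apply: val_inj.
Qed.

Fact one2E a b : (1 : 'M[A]_2) a b = (a == b)%:R.
Proof. by rewrite [LHS]mxE. Qed.

Fact op_row1 (f : F) : op f 1 0 = 0 /\ op f 1 1 = rho f.
Proof.
pose f' : {malg R[{fmonom 'I_n}]} := f.
have Ew (w : {fmonom 'I_n}) :
    op_word w 1 0 = 0 /\ op_word w 1 1 = rho (<< w >> : F).
  rewrite -[w]fmK; elim: (w : seq _) => [|j s [IH0 IH1]].
    have -> : << FMonom [::] >> = (1 : F) by rewrite -(fmoneE 'I_n).
    rewrite rmorph1 [op_word _]big_nil; split; first by rewrite one2E.
    by rewrite one2E.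
  have -> : << FMonom (j :: s) >> = X j * (<< FMonom s >> : F).
    rewrite /free_var [RHS]malgM_def fgmulUU mul1r; congr << _ >>.
    by rewrite [RHS]fmmulE fmuE.
  have -> : op_word (FMonom (j :: s)) = op_mx j * op_word (FMonom s).
    by rewrite /op_word /= big_cons.
  rewrite !mul2E IH0 IH1 !mxE /= rmorphM /=.
  by rewrite !mul0r !add0r mulr0.
have -> : f = \sum_(w <- msupp f') f'@_w *: (<< w >> : F).
  rewrite {1}[f](monalgE f'); apply: eq_bigr => w _.
  by apply/malgP => k; rewrite mcoeffZ !mcoeffU mulr_natr.
have opS (r : seq {fmonom 'I_n}) (G : {fmonom 'I_n} -> F) a b :
    op (\sum_(w <- r) G w) a b = \sum_(w <- r) op (G w) a b.
  by rewrite -summxE; congr (_ _ a b); exact: raddf_sum.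
split.
  by rewrite opS big1 // => w _; rewrite opZ op_mono (Ew w).1 scaler0.
rewrite opS [RHS]raddf_sum; apply: eq_bigr => w _.
rewrite opZ op_mono (Ew w).2; exact: (esym (linearZ_LR rho _ _)).
Qed.

Lemma operators_exist (sec : A -> F) : cancel sec rho ->
    (forall f, rho f = 0 -> op f = 0) ->
  exists (s : {lrmorphism A -> A}) (d : {linear A -> A}),
    is_sigma q (fun j => x j) i s /\ is_qdivdiff q (fun j => x j) i s d.
Proof.
move=> secK op_ker.
have opFB f g : op (f - g) = op f - op g by exact: raddfB.
have rhoB f g : rho (f - g) = rho f - rho g by exact: raddfB.
have opFM f g : op (f * g) = op f * op g by exact: rmorphM.
have rhoM f g : rho (f * g) = rho f * rho g by exact: rmorphM.
have rhoZ c f : rho (c *: f) = c *: rho f by exact: linearZ_LR.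
have opE f g : rho f = rho g -> op f = op g.
  by move=> fg; apply/subr0_eq; rewrite -opFB op_ker // rhoB fg subrr.
have op_sec f : op (sec (rho f)) = op f by apply: opE; rewrite secK.
have opB u v : op (sec (u - v)) = op (sec u) - op (sec v).
  by rewrite -opFB; apply: opE; rewrite rhoB !secK.
have opM u v : op (sec (u * v)) = op (sec u) * op (sec v).
  by rewrite -opFM; apply: opE; rewrite rhoM !secK.
have opSc c u a b : op (sec (c *: u)) a b = c *: op (sec u) a b.
  by rewrite -opZ; congr (_ _ a b); apply: opE; rewrite rhoZ !secK.
have op1 : op (sec 1) = 1.
  have -> : op (sec 1) = op 1 by apply: opE; rewrite secK [RHS]rmorph1.
  exact: rmorph1.
pose s u := op (sec u) 0 0; pose d u := op (sec u) 0 1.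
have s_add : zmod_morphism s by move=> u v; rewrite /s opB !mxE.
have d_add : zmod_morphism d by move=> u v; rewrite /d opB !mxE.
have s_mul : monoid_morphism s.
  split; first by rewrite /s op1 mxE.
  by move=> u v; rewrite /s opM mul2E (op_row1 (sec v)).1 mulr0 addr0.
have s_sc : scalable s by move=> c u; rewrite /s opSc.
have d_sc : scalable d by move=> c u; rewrite /d opSc.
pose s1 := GRing.isZmodMorphism.Build A A s s_add.
pose s2 := GRing.isMonoidMorphism.Build A A s s_mul.
pose s3 := GRing.isScalable.Build R A A *:%R s s_sc.
pose d1 := GRing.isZmodMorphism.Build A A d d_add.
pose d3 := GRing.isScalable.Build R A A *:%R d d_sc.
pose sL : {lrmorphism A -> A} := HB.pack s s1 s2 s3.
pose dL : {linear A -> A} := HB.pack d d1 d3.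
have lohi : (hi == lo) = false by apply/negbTE; rewrite -val_eqE /= gtn_eqF.
have sx j : sL (x j) = sigma_img j by rewrite /= /s op_sec op_var mxE.
have dx j : dL (x j) = del_img j by rewrite /= /d op_sec op_var mxE.
exists sL, dL; split; split.
- by rewrite sx /sigma_img eqxx.
- by rewrite sx /sigma_img lohi eqxx.
- move=> j hj; rewrite sx /sigma_img -!val_eqE /= !gtn_eqF //; last first.
    exact: ltn_trans hj.
  by rewrite ltnNge (ltnW (ltn_trans _ hj)).
- move=> j jl; rewrite sx /sigma_img -!val_eqE /= !ltn_eqF // ?jl //.
  exact: (ltn_trans jl).
- by rewrite dx /del_img eqxx.
- by rewrite dx /del_img lohi eqxx.
- by move=> j jl jh; rewrite dx /del_img (negPf jl) (negPf jh).
- move=> f g; rewrite /= /d /s opM mul2E (op_row1 (sec g)).2 secK.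
  by rewrite addrC.
Qed.

Lemma op_mx_qcomm : q ^+ 2 = 1 ->
    (forall a b : 'I_n, (a < b)%N -> x b * x a = q *: (x a * x b)) ->
  forall j k : 'I_n, (j < k)%N -> forall a b : 'I_2,
    (op_mx k * op_mx j) a b = q *: (op_mx j * op_mx k) a b.
Proof.
move=> q2 xC j k jk a b.
have qq : q * q = 1 by rewrite -expr2.
have qV : q^-1 = q.
  by rewrite -[LHS]mul1r -qq mulrK //; apply/unitrP; exists q.
have lohi : (lo < hi)%N by rewrite /=.
pose y (j : 'I_n) := x j.
have {}xC (c d : 'I_n) : (c < d)%N -> y d * y c = q *: (y c * y d).
  exact: xC.
pose tau (c : 'I_n) := if c == lo then hi else if c == hi then lo else c.
pose dc (c : 'I_n) : R := if c == lo then q else if c == hi then -1 else 0.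
have opx c : op_mx c 1 1 = y c by rewrite mxE.
have opl c : op_mx c 1 0 = 0 by rewrite mxE.
have ops c : op_mx c 0 0 = q *: y (tau c).
  rewrite mxE /= /sigma_img qV /tau; case: (c == lo) => //.
  by case: (c == hi); case: (c < lo)%N.
have opd c : op_mx c 0 1 = dc c *: 1.
  rewrite mxE /= /del_img /dc; case: (c == lo) => //.
  by case: (c == hi); rewrite ?scaleN1r ?scale0r.
have hilo : (hi == lo) = false by rewrite -val_eqE /= gtn_eqF.
have ltV (c d : 'I_n) : (c < d)%N -> (d == c) = false.
  by move=> cd; rewrite -val_eqE /= gtn_eqF.
have b2 (c : 'I_2) : c = 0 \/ c = 1.
  by case: c => [[|[|c]] hc] //; [left | right]; apply: val_inj.
move: op_mx opx opl ops opd => M opx opl ops opd.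
have E00 c d : (M c * M d) 0 0 = (q *: y (tau c)) * (q *: y (tau d)).
  by rewrite mul2E (ops c) (ops d) (opl d) mulr0 addr0.
have E01 c d : (M c * M d) 0 1
    = (q *: y (tau c)) * (dc d *: 1) + (dc c *: 1) * y d.
  by rewrite mul2E (ops c) (opd c) (opd d) (opx d).
have E10 c d : (M c * M d) 1 0 = 0.
  by rewrite mul2E (opl c) (opl d) mul0r mulr0 addr0.
have E11 c d : (M c * M d) 1 1 = y c * y d.
  by rewrite mul2E (opl c) (opx c) (opx d) mul0r add0r.
have [-> | ->] := b2 a; have [-> | ->] := b2 b.
- rewrite (E00 k j) (E00 j k); clear - qq xC jk lohi hilo.
  rewrite -!scalerAl -!scalerAr !scalerA qq mul1r scale1r.
  have [[jl kh]|jk'] := pselect (j = lo /\ k = hi).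
    rewrite jl kh /tau !eqxx hilo (xC _ _ lohi).
    by rewrite scalerA qq scale1r.
  apply: xC; rewrite /tau.
  have [jl|/eqP jl] := eqVneq j lo; have [kl|/eqP kl] := eqVneq k lo.
  + by move: jk; rewrite jl kl ltnn.
  + have [kh|/eqP kh] := eqVneq k hi; first by case: jk'.
    move: jk; rewrite jl [X in (X < _)%N -> _]/= => lk.
    rewrite ltn_neqAle; apply/andP; split=> //.
    by apply/eqP => e; apply: kh; apply/val_inj.
  + have [jh|/eqP jh] := eqVneq j hi.
      by move: jk; rewrite jh kl ltnNge (ltnW lohi).
    by apply: leq_trans lohi; rewrite ltnS -kl ltnW.
  + have [jh|/eqP jh] := eqVneq j hi; have [kh|/eqP kh] := eqVneq k hi => //.
    * by move: jk; rewrite jh kh ltnn.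
    * by apply: ltn_trans jk; rewrite jh.
    move: jk; rewrite kh [X in (_ < X)%N]/= ltnS leq_eqVlt => /orP[/eqP e|//].
    by case: jl; apply: val_inj.
- rewrite (E01 k j) (E01 j k); clear - qq xC jk lohi hilo.
  have scal (r : R) (u : A) : u * (r *: 1) = r *: u by rewrite -scalerAr mulr1.
  have scar (r : R) (u : A) : (r *: 1) * u = r *: u by rewrite -scalerAl mul1r.
  rewrite !scal !scar !scalerA scalerDr !scalerA.
  have -> : q * (dc k * q) = dc k by rewrite mulrCA qq mulr1.
  suff : (dc j * q) *: (y (tau k) - y k) = dc k *: (y (tau j) - y j).
    rewrite !scalerBr [q * dc j]mulrC => /eqP.
    by rewrite subr_eq addrAC eq_sym subr_eq => /eqP ->.
  rewrite /dc /tau.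
  have [jl|/eqP jl] := eqVneq j lo; have [kl|/eqP kl] := eqVneq k lo.
  + by move: jk; rewrite jl kl ltnn.
  + have [kh|/eqP kh] := eqVneq k hi; last by rewrite subrr scaler0 scale0r.
    by rewrite kh jl qq scale1r scaleN1r opprB.
  + have [jh|/eqP jh] := eqVneq j hi.
      by move: jk; rewrite jh kl ltnNge (ltnW lohi).
    by rewrite mul0r scale0r subrr scaler0.
  + have [jh|/eqP jh] := eqVneq j hi; have [kh|/eqP kh] := eqVneq k hi.
    * by move: jk; rewrite jh kh ltnn.
    * by rewrite subrr scaler0 scale0r.
    * by rewrite mul0r scale0r subrr scaler0.
    by rewrite mul0r !scale0r.
- by rewrite (E10 k j) (E10 j k) scaler0.
- by rewrite (E11 k j) (E11 j k); apply: xC.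
Qed.

End Existence.

Lemma free_operators_exist (R : comUnitRingType) (n : nat) (q : R)
    (i : 'I_n.-1) :
  exists (s : {lrmorphism free_alg R n -> free_alg R n})
         (d : {linear free_alg R n -> free_alg R n}),
    is_sigma q (@free_var R n) i s /\ is_qdivdiff q (@free_var R n) i s d.
Proof.
apply: (@operators_exist R n q _ idfun i id) => // f /= ->.
exact: raddf0.
Qed.

Lemma qpoly_alg_operators_exist (R : comUnitRingType) (n : nat) (q : R)
    (i : 'I_n.-1) : q ^+ 2 = 1 ->
  exists (s : {lrmorphism qpoly_alg n q -> qpoly_alg n q})
         (d : {linear qpoly_alg n q -> qpoly_alg n q}),
    is_sigma q (@qvar R n q) i s /\ is_qdivdiff q (@qvar R n q) i s d.
Proof.
move=> q2; pose op := op q (@qpi R n q) i.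
have op0 : op 0 = 0 by exact: raddf0.
have opB f g : op (f - g) = op f - op g by exact: raddfB.
have opM f g : op (f * g) = op f * op g by exact: rmorphM.
apply: (@operators_exist R n q _ (@qpi R n q) i repr); first exact: qpi_reprK.
move=> f; rewrite -(raddf0 (@qpi R n q)) => /qpiP; rewrite subr0.
suff: {subset @qideal R n q <= [pred g | op g == 0]}.
  by move=> H /H; rewrite inE => /eqP.
apply: qideal_min; first split; first split.
- by rewrite inE op0.
- by move=> u v; rewrite !inE opB => /eqP-> /eqP->; rewrite subrr.
- by move=> a b u; rewrite !inE !opM => /eqP->; rewrite mulr0 mul0r.
move=> j k jk; rewrite inE.
have opE : op (qrel q j k) = op_mx q (@qpi R n q) i k * op_mx q (@qpi R n q) i j
    - op (q *: (free_var R j * free_var R k)).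
  by rewrite -!op_var -opM -opB.
apply/eqP/matrixP => a b; rewrite opE [LHS]mxE [X in _ + X]mxE opZ.
rewrite (@op_mx_qcomm R n q _ (@qpi R n q) i q2 _ j k jk); last first.
  exact: qvar_comm.
by rewrite -/op opM /op !op_var subrr mxE.
Qed.

(* Main.v *)
Require Import Defs.
From HB Require Import structures.
From mathcomp Require Import all_boot all_order all_fingroup all_algebra.

(** The operator [del_i] kills every variable other than [x_i] and [x_(i+1)],
    so by the q-Leibniz rule it only acts on the middle factor [m] of a monomial
    [u m v] in which [u] and [v] avoid these two variables.  An increasing
    monomial has this shape, with [u] before position [i], [v] after position
    [i+1], and [m] one of [1], [~x_i], [~x_(i+1)], [~x_i ~x_(i+1)].

    The twist is chosen so that [sigma_i ~x_i = ~x_(i+1)] and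
    [del_i ~x_(i+1) = - del_i ~x_i], the latter being a scalar.  Hence
    [del_i (~x_i ~x_(i+1)) = 0], and the monomials with [m = 1] or
    [m = ~x_i ~x_(i+1)] are annihilated ([qdivdiff_mono_fixed]).  The others
    come in pairs [u ~x_i v], [u ~x_(i+1) v] exchanged by the transposition of
    the two indices, and [del_i] takes opposite values on the two members of a
    pair ([qdivdiff_mono_swap]), so the sum defining [~e_k] is sent to [0].

    The argument takes place in an arbitrary algebra with elements [x_j] and
    maps [sigma_i], [del_i] as above, so that the free algebra and its quotient
    are treated together.  Finally, the kernel of a twisted derivation is a
    subalgebra, so it contains everything that the [~e_k] generate. *)

Set Implicit Arguments.
Unset Strict Implicit.
Unset Printing Implicit Defensive.

Import GRing.Theory.
Local Open Scope ring_scope.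

(** * Kernels of twisted derivations *)

Section TwistedDerivation.
Variables (R : comUnitRingType) (A : algType R).
Variables (s : {lrmorphism A -> A}) (d : {linear A -> A}).
Hypothesis d_leibniz : forall f g : A, d (f * g) = d f * g + s f * d g.

Lemma twisted_der1 : d 1 = 0.
Proof.
have /eqP := d_leibniz 1 1.
by rewrite !mulr1 rmorph1 mul1r -subr_eq0 opprD addrA subrr sub0r oppr_eq0
  => /eqP.
Qed.

Lemma twisted_derM0 (f g : A) : d f = 0 -> d g = 0 -> d (f * g) = 0.
Proof. by move=> df dg; rewrite d_leibniz df dg mul0r mulr0 addr0. Qed.

Lemma twisted_der_prod0 (I : eqType) (r : seq I) (F : I -> A) :
  {in r, forall j, d (F j) = 0} -> d (\prod_(j <- r) F j) = 0.
Proof.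
move=> dF; rewrite big_seq; elim/big_ind: _ => //; first exact: twisted_der1.
exact: twisted_derM0.
Qed.

Lemma twisted_der_mid (u m v : A) :
  d u = 0 -> d v = 0 -> d (u * (m * v)) = s u * (d m * v).
Proof. by move=> du dv; rewrite !d_leibniz du dv mul0r add0r mulr0 addr0. Qed.

Lemma twisted_der_ker_subalg : subalg_closed [pred f | d f == 0].
Proof.
split=> [|c f g|f g]; rewrite !inE; first by rewrite twisted_der1.
  by move=> /eqP df /eqP dg; rewrite linearP df dg scaler0 addr0.
by move=> /eqP df /eqP dg; rewrite twisted_derM0.
Qed.

Lemma twisted_der_gen_subalg (S : A -> Prop) (f : A) :
  (forall g, S g -> d g = 0) -> gen_subalg S f -> d f = 0.
Proof.
move=> dS Sf; apply/eqP; apply: (Sf _ twisted_der_ker_subalg) => g /dS dg.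
by rewrite inE dg.
Qed.

End TwistedDerivation.

(** * Increasing sequences and adjacent transpositions *)

Section IncreasingSequences.
Variables (n : nat) (i : 'I_n.-1).
Local Notation lo := (var_lo i).
Local Notation hi := (var_hi i).
Local Notation ord_lt := (fun a b : 'I_n => (a < b)%N).

Let ord_lt_trans : transitive ord_lt.
Proof. by move=> b a c; apply: ltn_trans. Qed.

(** Strictly increasing sequences with the same elements are equal, and no
    index lies strictly between [lo] and [hi]. *)
Lemma increasing_split (r : seq 'I_n) : sorted ord_lt r ->
  r = [seq j : 'I_n <- r | (j < lo)%N]
      ++ [seq j : 'I_n <- [:: lo; hi] | j \in r]
      ++ [seq j : 'I_n <- r | (hi < j)%N].
Proof.
move=> r_sorted; apply: (irr_sorted_eq ord_lt_trans) => //.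
- by move=> j; rewrite /= ltnn.
- have filter_pw (P : pred 'I_n) (t : seq 'I_n) :
      sorted ord_lt t -> pairwise ord_lt (filter P t).
    by move=> t_sorted; rewrite -sorted_pairwise // sorted_filter.
  have lohi_sorted : sorted ord_lt [:: lo; hi] by rewrite /= ltnSn.
  rewrite sorted_pairwise // !pairwise_cat !filter_pw // !andbT /(true && _).
  apply/andP; split; apply/allrelP => a b.
    rewrite mem_cat !mem_filter !inE => /andP[a_lo _].
    case/orP=> /andP[].
      by move=> _ /orP[]/eqP-> //=; apply: ltn_trans a_lo (ltnSn _).
    by move=> hi_b _; apply: ltn_trans hi_b; apply: ltn_trans a_lo (ltnSn _).
  rewrite !mem_filter !inE => /andP[_ a_mid] /andP[hi_b _].
  case/orP: a_mid => /eqP-> //.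
  by apply: ltn_trans hi_b; rewrite /= ltnSn.
- move=> j; rewrite !mem_cat !mem_filter !inE -!val_eqE /=.
  case: (j \in r); rewrite ?andbF ?andbT //=.
  by case: (ltngtP j i) => //= lo_j; rewrite [(j == _ :> nat)]eq_sym -leq_eqVlt.
Qed.

Lemma mem_swap_lo (r : seq 'I_n) : (lo \in map (tperm lo hi) r) = (hi \in r).
Proof. by rewrite -[X in X \in map _ _](tpermR lo hi) (mem_map perm_inj). Qed.

Lemma mem_swap_hi (r : seq 'I_n) : (hi \in map (tperm lo hi) r) = (lo \in r).
Proof. by rewrite -[X in X \in map _ _](tpermL lo hi) (mem_map perm_inj). Qed.

(** The transposition of [lo] and [hi] reverses the order of these two adjacent
    indices only. *)
Lemma increasing_map_tperm (r : seq 'I_n) : ~~ ((lo \in r) && (hi \in r)) ->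
  sorted ord_lt (map (tperm lo hi) r) = sorted ord_lt r.
Proof.
have swap_sorted (t : seq 'I_n) : ~~ ((lo \in t) && (hi \in t)) ->
    sorted ord_lt t -> sorted ord_lt (map (tperm lo hi) t).
  move=> not_both.
  have swap_mono : {in t &, {homo tperm lo hi : a b / (a < b)%N}}.
    move=> a b a_t b_t /=.
    case: tpermP => [a_lo|a_hi|a_lo a_hi];
      case: tpermP => [b_lo|b_hi|b_lo b_hi].
    - by rewrite a_lo b_lo ltnn.
    - by move: not_both; rewrite -a_lo -b_hi a_t b_t.
    - rewrite a_lo => lo_b; rewrite ltn_neqAle eq_sym (inj_eq val_inj).
      by rewrite (introF eqP b_hi).
    - by rewrite a_hi b_lo => _; apply: ltnSn.
    - by rewrite a_hi b_hi ltnn.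
    - by rewrite a_hi; apply: ltn_trans; apply: ltnSn.
    - by rewrite b_lo => a_b; apply: ltn_trans a_b (ltnSn _).
    - rewrite b_hi => a_b; rewrite ltn_neqAle (inj_eq val_inj).
      by rewrite (introF eqP a_lo).
    - by [].
  exact: homo_sorted_in swap_mono (introT allP (fun j jt => jt)).
move=> not_both; apply/idP/idP; last exact: swap_sorted.
move=> r_sorted; rewrite -[r](mapK (tpermK lo hi)); apply: swap_sorted => //.
by rewrite mem_swap_lo mem_swap_hi andbC.
Qed.

End IncreasingSequences.

(** * q-divided differences of increasing monomials *)

Section QDividedDifference.
Variables (R : comUnitRingType) (n : nat) (q : R).
Variables (A : algType R) (x : 'I_n -> A) (i : 'I_n.-1).
Variables (s : {lrmorphism A -> A}) (d : {linear A -> A}).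
Hypotheses (s_sigma : is_sigma q x i s) (d_qdd : is_qdivdiff q x i s d).

Local Notation lo := (var_lo i).
Local Notation hi := (var_hi i).
Local Notation xt := (twisted_var q x).
Local Notation mono r := (\prod_(j <- r) xt j).
Local Notation ord_lt := (fun a b : 'I_n => (a < b)%N).

Let leibniz : forall f g : A, d (f * g) = d f * g + s f * d g.
Proof. by case: d_qdd. Qed.

Lemma sigma_twisted_lo : s (xt lo) = xt hi.
Proof.
by case: s_sigma => s_lo _ _ _; rewrite [LHS]linearZ_LR /= s_lo scalerA -exprSr.
Qed.

Lemma qdivdiff_twisted_lo : d (xt lo) = (q ^+ hi)%:A.
Proof.
by case: d_qdd => d_lo _ _ _; rewrite [LHS]linearZ_LR /= d_lo scalerA -exprSr.
Qed.

Lemma qdivdiff_twisted_hi : d (xt hi) = - (q ^+ hi)%:A.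
Proof.
by case: d_qdd => _ d_hi _ _; rewrite [LHS]linearZ_LR /= d_hi scalerN.
Qed.

Lemma qdivdiff_twisted_other (j : 'I_n) : j != lo -> j != hi -> d (xt j) = 0.
Proof.
by case: d_qdd => _ _ d_j _ jlo jhi; rewrite [LHS]linearZ_LR /= d_j // scaler0.
Qed.

Lemma qdivdiff_twisted_lohi : d (xt lo * xt hi) = 0.
Proof.
rewrite leibniz sigma_twisted_lo qdivdiff_twisted_lo qdivdiff_twisted_hi.
by rewrite mulrN mulr_algl mulr_algr subrr.
Qed.

Lemma qdivdiff_mono_mid (u m v : seq 'I_n) :
  {in u, forall j : 'I_n, (j < lo)%N} -> {in v, forall j : 'I_n, (hi < j)%N} ->
  d (mono (u ++ m ++ v)) = s (mono u) * (d (mono m) * mono v).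
Proof.
move=> u_lo v_hi; rewrite !big_cat; apply: (twisted_der_mid leibniz).
  apply: (twisted_der_prod0 leibniz) => j /u_lo j_lo.
  apply: qdivdiff_twisted_other; rewrite -val_eqE ltn_eqF //.
  exact: ltn_trans j_lo (ltnSn _).
apply: (twisted_der_prod0 leibniz) => j /v_hi hi_j.
apply: qdivdiff_twisted_other; rewrite -val_eqE gtn_eqF //.
exact: ltn_trans (ltnSn _) hi_j.
Qed.

Lemma qdivdiff_mono_fixed (r : seq 'I_n) : sorted ord_lt r ->
  (lo \in r) = (hi \in r) -> d (mono r) = 0.
Proof.
move=> r_sorted lo_hi; rewrite (increasing_split i r_sorted) qdivdiff_mono_mid.
- rewrite /= lo_hi; case: (hi \in r); rewrite ?big_cons big_nil ?mulr1.
    by rewrite qdivdiff_twisted_lohi mul0r mulr0.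
  by rewrite (twisted_der1 leibniz) mul0r mulr0.
- by move=> j; rewrite mem_filter => /andP[].
- by move=> j; rewrite mem_filter => /andP[].
Qed.

Lemma qdivdiff_mono_swap (r : seq 'I_n) : sorted ord_lt r ->
  lo \in r -> hi \notin r ->
  d (mono (map (tperm lo hi) r)) = - d (mono r).
Proof.
move=> r_sorted lo_r hi_r; move: (increasing_split i r_sorted).
rewrite /= lo_r (negPf hi_r).
set u := filter _ r; set v := filter (fun j : 'I_n => (hi < j)%N) r.
have u_lo : {in u, forall j : 'I_n, (j < lo)%N}.
  by move=> j; rewrite mem_filter => /andP[].
have v_hi : {in v, forall j : 'I_n, (hi < j)%N}.
  by move=> j; rewrite mem_filter => /andP[].
move=> ->; rewrite !map_cat.
have -> : map (tperm lo hi) u = u.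
  apply: map_id_in => j /u_lo j_lo; rewrite tpermD // -val_eqE gtn_eqF //.
  exact: ltn_trans j_lo (ltnSn _).
have -> : map (tperm lo hi) v = v.
  apply: map_id_in => j /v_hi hi_j; rewrite tpermD // -val_eqE ltn_eqF //.
  exact: ltn_trans (ltnSn _) hi_j.
rewrite [map _ [:: lo]]/= tpermL !qdivdiff_mono_mid // !big_seq1.
by rewrite qdivdiff_twisted_lo qdivdiff_twisted_hi mulNr mulrN.
Qed.

Lemma qdivdiff_twisted_esym (k : nat) : d (twisted_esym q x k) = 0.
Proof.
rewrite /twisted_esym linear_sum /=.
rewrite (bigID (fun t : k.-tuple 'I_n => (lo \in t) == (hi \in t))) /=.
rewrite big1 ?add0r => [|t /andP[t_sorted /eqP]]; last first.
  exact: qdivdiff_mono_fixed.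
rewrite (bigID (fun t : k.-tuple 'I_n => lo \in t)) /=.
pose swap (t : k.-tuple 'I_n) := [tuple of map (tperm lo hi) t].
have swapK : involutive swap.
  by move=> t; apply/val_inj/(mapK (tpermK lo hi)).
rewrite [X in _ + X](reindex_inj (inv_inj swapK)) /=.
(* After swapping, both sums range over the tuples that contain lo, not hi. *)
rewrite [X in _ + X](eq_bigl (fun t : k.-tuple 'I_n =>
    [&& sorted ord_lt t, (lo \in t) != (hi \in t) & lo \in t])); last first.
  move=> t; rewrite mem_swap_lo mem_swap_hi.
  have := @increasing_map_tperm n i t.
  by case: (lo \in t); case: (hi \in t) => /= sorted_swap;
    rewrite ?andbF ?andbT ?sorted_swap.
rewrite [X in X + _](eq_bigl (fun t : k.-tuple 'I_n =>
    [&& sorted ord_lt t, (lo \in t) != (hi \in t) & lo \in t])); last first.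
  by move=> t; rewrite andbA.
rewrite -big_split big1 // => t /and3P[t_sorted lo_neq lo_t] /=.
rewrite qdivdiff_mono_swap ?subrr //.
by move: lo_neq; rewrite lo_t; case: (hi \in t).
Qed.

Lemma qdivdiff_twisted_Lambda (f : A) : twisted_Lambda q x f -> d f = 0.
Proof.
apply: (twisted_der_gen_subalg leibniz) => g [k [_ ->]].
exact: qdivdiff_twisted_esym.
Qed.

End QDividedDifference.

(* First conjunct: the claim on the q-polynomial algebra, for all sigma_i and
   del_i with the stated defining properties. Second conjunct: the same claim
   before imposing the relations, where sigma_i and del_i exist for every q. *)
Theorem lemma5p9 (R : comUnitRingType) (n : nat) (q : R)
    (hq : q \is a GRing.unit) :
  (forall (sigma : 'I_n.-1 -> {lrmorphism qpoly_alg n q -> qpoly_alg n q})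
          (del : 'I_n.-1 -> {linear qpoly_alg n q -> qpoly_alg n q}),
     (forall i, is_sigma q (@qvar R n q) i (sigma i)) ->
     (forall i, is_qdivdiff q (@qvar R n q) i (sigma i) (del i)) ->
     (forall (i : 'I_n.-1) (k : nat), (1 <= k)%N ->
        del i (twisted_esym q (@qvar R n q) k) = 0)
     /\ (forall f : qpoly_alg n q, twisted_Lambda q (@qvar R n q) f ->
           forall i : 'I_n.-1, del i f = 0))
  /\
  (forall (sigma : 'I_n.-1 -> {lrmorphism free_alg R n -> free_alg R n})
          (del : 'I_n.-1 -> {linear free_alg R n -> free_alg R n}),
     (forall i, is_sigma q (@free_var R n) i (sigma i)) ->
     (forall i, is_qdivdiff q (@free_var R n) i (sigma i) (del i)) ->
     (forall (i : 'I_n.-1) (k : nat), (1 <= k)%N ->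
        del i (twisted_esym q (@free_var R n) k) = 0)
     /\ (forall f : free_alg R n, twisted_Lambda q (@free_var R n) f ->
           forall i : 'I_n.-1, del i f = 0)).
Proof.
split=> sigma del sigmaP delP; split.
- by move=> i k _; apply: qdivdiff_twisted_esym (sigmaP i) (delP i) k.
- by move=> f Lf i; apply: qdivdiff_twisted_Lambda (sigmaP i) (delP i) f Lf.
- by move=> i k _; apply: qdivdiff_twisted_esym (sigmaP i) (delP i) k.
- by move=> f Lf i; apply: qdivdiff_twisted_Lambda (sigmaP i) (delP i) f Lf.
Qed.
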